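(* Let $t\geq 3$ be a fixed integer. There is a $t$-reachability network on $n$ elements of length at most $(2+o_t(1))n$, where $o_t(1)$ denotes a quantity, depending on $t$ and $n$, which for fixed $t$ tends to $0$ as $n\to\infty$. Equivalently, for every $t\ge 3$ and every $\delta>0$ there is $n_0=n_0(t,\delta)$ such that for all $n\ge n_0$ there exists a $t$-reachability network on $n$ elements of length at most $(2+\delta)n$.
   Context: Write $[n]=\{1,\dots,n\}$, let $S_n$ be the symmetric group on $[n]$, and for distinct $a,b\in[n]$ let $(a,b)\in S_n$ denote the transposition swapping $a$ and $b$. For $1\le t\le n$, a finite sequence of transpositions $T_1,\dots,T_\ell\in S_n$ (repetitions allowed), with $T_i=(a_i,b_i)$, is a $t$-reachability network on $n$ elements if for every choice of $t$ distinct ordered points $x_1,\dots,x_t\in[n]$ there is a (possibly empty) subsequence $T_{i_1},\dots,T_{i_{\ell'}}$ with $i_1<\dots<i_{\ell'}$ whose composition $(a_{i_1},b_{i_1})\cdots(a_{i_{\ell'}},b_{i_{\ell'}})$ maps $j\mapsto x_j$ for every $1\le j\le t$. Products are applied in the order of the sequence, left to right: $T_{i_1}$ is applied first (equivalently, counters placed at positions $1,\dots,t$ are moved by carrying out the chosen switches in order, and counter $j$ must end at position $x_j$). The length of the network is $\ell$, the number of transpositions in the sequence. *)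

(* Defs.v *)
From mathcomp Require Import all_boot all_order all_algebra all_fingroup.
From mathcomp Require Import reals.

Set Implicit Arguments.
Unset Strict Implicit.
Unset Printing Implicit Defensive.

(* The points 1, ..., n are represented by the elements 0, ..., n - 1 of 'I_n,
   so the counters 1, ..., t start at the ordinals of value 0, ..., t - 1.
   A pair (a, b) stands for the transposition [tperm a b]. *)

(* MathComp composes permutations left to right, [(s * u) x = u (s x)], so the
   first transposition of the sequence is the one applied first. *)
Definition switch_prod (n : nat) (s : seq ('I_n * 'I_n)) : 'S_n :=
  (\prod_(p <- s) tperm p.1 p.2)%g.

Definition reachability_network (t n : nat) (T : seq ('I_n * 'I_n)) : Prop :=
  [/\ 1 <= t <= n,
      all (fun p => p.1 != p.2) T
    & forall x : 'I_t -> 'I_n, injective x ->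
        exists2 s : seq ('I_n * 'I_n), subseq s T &
          (* [j] is [i] seen as a point of 'I_n; it exists since t <= n. *)
          forall (i : 'I_t) (j : 'I_n), val j = val i -> switch_prod s j = x i].

(* Main.v *)
(* A network is run backwards, so that tokens at arbitrary distinct points
   x_1, ..., x_t have to be brought to 1, ..., t.  Fix a set H of o(n) points,
   made of 1, ..., t and of hubs.  Tokens starting in H are first gathered at
   their targets, which frees the hubs; every point outside H is then offered a
   switch with each of two hubs (2n switches), and finally all tokens, now in
   H, are gathered.  Gathering inside H costs at most t|H| = o(n) switches.

   The two hubs of a point are the ends of an edge of a graph on the hubs, and
   the middle stage succeeds as soon as any t edges form a forest, for then
   they have distinct representatives among their ends.  Graphs with this
   property and arbitrarily large edge/vertex ratio L come from L parallel edges
   by iterating the (Z/2)^E-cover, which keeps the ratio and increases the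
   least number of edges of a non-forest; disjoint copies then supply all
   large n. *)
Require Import Defs.
From mathcomp Require Import all_boot all_order all_algebra all_fingroup.
From mathcomp Require Import reals.
From mathcomp Require Import zify.

Set Implicit Arguments.
Unset Strict Implicit.
Unset Printing Implicit Defensive.

Import Order.TTheory GRing.Theory Num.Theory.

(** * Multigraphs whose small edge sets are forests *)

Section Multigraph.
Variables (V E : finType) (src dst : E -> V).

Definition incident (e : E) (v : V) := (src e == v) || (dst e == v).

Definition leaf_edge (F : {set E}) (v : V) (e : E) :=
  [/\ e \in F, incident e v & {in F, forall e', incident e' v -> e' = e}].

(* For multigraphs this says that any [k] edges form a forest: a forest with an
   edge has two leaves, one of which differs from [w].  Asking for two leaves
   instead of one is what makes the induction along covers go through. *)
Definition forest_upto (k : nat) :=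
  forall F : {set E}, F != set0 -> #|F| <= k ->
  forall w : V, exists2 v, v != w & exists e, leaf_edge F v e.

(** Peel off a leaf edge [e] and let its leaf [v] represent it: no other edge of [F] touches [v], so
    the representatives given by induction avoid [v]. *)
Lemma forest_upto_sdr k (F : {set E}) : forest_upto k -> #|F| <= k ->
  exists2 f : E -> V, {in F &, injective f} & forall e, incident e (f e).
Proof.
move=> good; elim: {F}_.+1 {-2}F (ltnSn #|F|) => // m IH F Fm Fk.
have [->|F0] := eqVneq F set0.
  by exists src => [e e'|e]; rewrite ?inE // /incident eqxx.
have [e0 e0F] := set0Pn _ F0.
have [v _ [e [eF ev leaf]]] := good F F0 Fk (src e0).
have cF := cardsD1 e F; rewrite eF /= in cF.
have [f injf incf] : exists2 f : E -> V,
  {in F :\ e &, injective f} & forall e, incident e (f e) by apply: IH; lia.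
exists (fun e' => if e' == e then v else f e') => [e1 e2 e1F e2F|e1]; last first.
  by case: eqP => [->|].
have fNv e' : e' \in F -> e' != e -> f e' != v.
  by move=> e'F; apply: contraNneq => fv; apply/eqP/leaf => //; rewrite -fv.
case: eqVneq => [->|n1]; case: eqVneq => [->|n2] //.
- by move/esym/eqP; rewrite (negPf (fNv _ _ _)).
- by move/eqP; rewrite (negPf (fNv _ _ _)).
- by apply: injf; rewrite !inE ?n1 ?n2.
Qed.

End Multigraph.

(** * The [(Z/2)^E]-cover of a loopless multigraph *)

Section Cover.
Variables (V E : finType) (src dst : E -> V).
Hypothesis loopless : forall e, src e != dst e.

Definition toggle (e : E) (s : {set E}) := [set x | (x \in s) (+) (x == e)].

(* The cover has vertex set [V * {set E}]; the lift of an edge [e] flips the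
   coordinate [e]. *)
Definition cover_src (e : E * {set E}) : V * {set E} := (src e.1, e.2).
Definition cover_dst (e : E * {set E}) : V * {set E} := (dst e.1, toggle e.1 e.2).

Lemma toggleK e : involutive (toggle e).
Proof. by move=> s; apply/setP=> x; rewrite !inE -addbA addbb addbF. Qed.

Lemma cover_loopless e : cover_src e != cover_dst e.
Proof. by apply: contra (loopless e.1) => /eqP[->]. Qed.

Lemma incident_cover_fst e v :
  incident cover_src cover_dst e v -> incident src dst e.1 v.1.
Proof. by rewrite /incident => /orP[] /eqP <-; rewrite eqxx ?orbT. Qed.

(** Toggling is injective and the two ends of an edge lie in different fibres, so distinct lifts of
    one edge share no vertex. *)
Lemma incident_cover_inj e e' v :
  incident cover_src cover_dst e v -> incident cover_src cover_dst e' v ->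
  e.1 = e'.1 -> e = e'.
Proof.
case: e e' => [e s] [e' s'] + + /= ee'; rewrite -{}ee' => /orP[] /eqP <- /orP[] /eqP[].
- by move=> ->.
- by move=> eqv; have := loopless e; rewrite eqv eqxx.
- by move=> eqv; have := loopless e; rewrite eqv eqxx.
- by move/(inv_inj (toggleK e)) ->.
Qed.

(** A leaf of the projected edge set lifts to a leaf of [F], because a vertex of the cover meets at
    most one lift of each edge. *)
Lemma forest_upto_cover_proj k (F : {set E * {set E}}) w :
    forest_upto src dst k -> F != set0 -> #|[set e.1 | e in F]| <= k ->
  exists2 v, v != w & exists e, leaf_edge cover_src cover_dst F v e.
Proof.
move=> good /set0Pn[e0 e0F] Fk.
have pF0 : [set e.1 | e in F] != set0.
  by apply/set0Pn; exists e0.1; apply: imset_f.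
have [v vw [_ [/imsetP[e eF ->] ev leaf]]] := good _ pF0 Fk w.1.
have [v' ev' v'v] : exists2 v', incident cover_src cover_dst e v' & v'.1 = v.
  case/orP: ev => /eqP <-.
    by exists (cover_src e); rewrite // /incident eqxx.
  by exists (cover_dst e); rewrite // /incident eqxx orbT.
exists v'; first by apply: contra vw => /eqP <-; rewrite v'v.
exists e; split => // e' e'F e'v'; apply: (incident_cover_inj e'v' ev').
by apply: leaf; [apply: imset_f | rewrite -v'v; apply: incident_cover_fst].
Qed.

(* If [F] does not inject into [E], its projection is small and has the required
   leaf.  Otherwise only one edge [(e, s)] of [F] crosses the cut given by the
   coordinate [e], so the part [B] of [F] on the side of the cut not containing
   [w] is smaller than [F], and its leaves other than the end [b] of [(e, s)]
   are leaves of [F]. *)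
Lemma forest_upto_cover k : forest_upto src dst k ->
  forest_upto cover_src cover_dst k.+1.
Proof.
move=> good F F0 Fk w.
have [pFk|pFk] := leqP #|[set e.1 | e in F]| k.
  exact: forest_upto_cover_proj pFk.
have injF : {in F &, injective (fun e : E * {set E} => e.1)}.
  by apply/imset_injP; rewrite eqn_leq leq_imset_card (leq_trans Fk pFk).
have [[e s] eF] := set0Pn _ F0.
pose side (v : V * {set E}) := e \in v.2.
have sideE e' v : e' \in F -> e' != (e, s) ->
    incident cover_src cover_dst e' v -> side v = side (cover_src e').
  move=> e'F e'e /orP[] /eqP <- //; rewrite /side !inE.
  have -> : (e == e'.1) = false; last by rewrite addbF.
  by apply: contraNF e'e => /eqP ee'; apply/eqP/injF.
have [b eb [bw bside]] : exists2 b, incident cover_src cover_dst (e, s) b &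
    side b != side w /\
    forall v, incident cover_src cover_dst (e, s) v -> side v = side b -> v = b.
  have sideN : side (cover_dst (e, s)) = ~~ side (cover_src (e, s)).
    by rewrite /side /= !inE eqxx addbT.
  have [sw|sw] := eqVneq (side (cover_src (e, s))) (side w).
    exists (cover_dst (e, s)); first by rewrite /incident eqxx orbT.
    split; first by rewrite sideN sw; case: (side w).
    by move=> v /orP[] /eqP <- //; rewrite sideN; case: (side _).
  exists (cover_src (e, s)); first by rewrite /incident eqxx.
  by split=> // v /orP[] /eqP <- //; rewrite sideN; case: (side _).
pose B := [set e' in F :\ (e, s) | side (cover_src e') == side b].
(* If no other edge of [F] lies on this side, [b] itself is a leaf, with edge [(e, s)]. *)
have [B0|B0] := eqVneq B set0.
  exists b; first by apply: contraNneq bw => ->.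
  exists (e, s); split=> // e' e'F e'b; apply/eqP; apply: contraT => e'e.
  have : e' \in B by rewrite !inE e'e e'F /= (sideE _ _ e'F e'e e'b).
  by rewrite B0 inE.
have Bk : #|B| <= k.
  apply: leq_trans (subset_leq_card (_ : B \subset F :\ (e, s))) _.
    by apply/subsetP=> e'; rewrite !inE => /andP[].
  by have := cardsD1 (e, s) F; rewrite eF; lia.
have pBk := leq_trans (leq_imset_card (fun e : E * {set E} => e.1) B) Bk.
have [v vb [e' [e'B e'v leaf]]] := forest_upto_cover_proj b good B0 pBk.
move: e'B; rewrite !inE => /andP[/andP[e'e e'F] /eqP e'b].
have vside : side v = side b by rewrite (sideE _ _ e'F e'e e'v).
exists v; first by apply: contraNneq bw => <-; apply/eqP.
exists e'; split=> // e2 e2F e2v; apply: leaf => //.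
have e2e : e2 != (e, s).
  by apply: contraNneq vb => e2e; apply/eqP/bside => //; rewrite -e2e.
by rewrite !inE e2e e2F /= -vside (sideE _ _ e2F e2e e2v).
Qed.

End Cover.

(** * Dense multigraphs and the choice of hubs *)

Lemma exists_dense_forest_upto (k L : nat) : exists (V E : finType) (src dst : E -> V),
  [/\ 0 < #|V|, #|E| = L * #|V|, forall e, src e != dst e & forest_upto src dst k].
Proof.
elim: k => [|k [V [E [src [dst [V0 EV loopless good]]]]]].
  (* Two vertices joined by [2 * L] parallel edges have ratio [L]; for [k = 0] the forest condition
     is vacuous. *)
  exists bool, ('I_L * bool)%type, (fun=> false), (fun=> true).
  split; rewrite ?card_prod ?card_ord ?card_bool // => F F0.
  by rewrite leqn0 cards_eq0 (negPf F0).
exists (V * {set E})%type, (E * {set E})%type, (cover_src src), (cover_dst dst).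
split.
- by rewrite card_prod muln_gt0 V0; apply/card_gt0P; exists set0.
- by rewrite !card_prod EV mulnA.
- exact: cover_loopless.
- exact: forest_upto_cover.
Qed.

Lemma forest_upto_copies (V E C : finType) (src dst : E -> V) k :
  forest_upto src dst k ->
  forest_upto (fun e : E * C => (src e.1, e.2)) (fun e => (dst e.1, e.2)) k.
Proof.
move=> good F /set0Pn[[e0 c] e0F] Fk w.
pose Fc := [set e | (e, c) \in F].
have Fc0 : Fc != set0 by apply/set0Pn; exists e0; rewrite inE.
have Fck : #|Fc| <= k.
  have injc : injective (fun e : E => (e, c)) by move=> e e' [].
  rewrite -(card_imset _ injc); apply: leq_trans (subset_leq_card _) Fk.
  by apply/subsetP=> _ /imsetP[e + ->]; rewrite inE.
have [v vw [e [eF ev leaf]]] := good _ Fc0 Fck w.1.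
exists (v, c); first by apply: contraNneq vw => <-.
exists (e, c); split; first by rewrite inE in eF.
  by rewrite /incident /= !xpair_eqE eqxx !andbT.
move=> [e' c'] e'F; rewrite /incident /= !xpair_eqE -andb_orl => /andP[e'v /eqP cc'].
by rewrite cc' in e'F *; rewrite (leaf e') ?inE.
Qed.

Lemma exists_hubs (t K : nat) : 0 < K ->
  exists n0, forall n, n0 <= n -> exists m (h1 h2 : 'I_n -> 'I_n),
    [/\ K * (t + m) <= n, forall x, t <= h1 x < t + m, forall x, t <= h2 x < t + m
      & forall S : {set 'I_n}, #|S| <= t ->
        exists2 f : 'I_n -> 'I_n, {in S &, injective f} &
          forall x, (f x == h1 x) || (f x == h2 x)].
Proof.
move=> K0.
have [V [E [src [dst [V0 EV _ good]]]]] := exists_dense_forest_upto t (2 * K).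
have E0 : 0 < #|E| by rewrite EV !muln_gt0 K0 V0.
(* With [c] copies there are at least [n] edges and at most [n + #|E|]. Ratio [2 * K] then gives [2
   * K * (t + m) <= n + #|E| + 2 * K * t <= 2 * n]. *)
exists (#|E| + 2 * K * t) => n n_ge; pose c := (n %/ #|E|).+1.
pose m := #|{: V * 'I_c}|.
have Km : K * (t + m) <= n.
  have cE := leq_trunc_div n #|E|.
  have mE : 2 * K * m = #|E| * c by rewrite /m card_prod card_ord EV mulnA.
  rewrite /c mulnS [_ * (_ %/ _)]mulnC in mE; nia.
have tm_n : t + m <= n by apply: leq_trans Km; rewrite leq_pmull.
have nE : n <= #|{: E * 'I_c}|.
  by rewrite card_prod card_ord mulnC /c ltnW // ltn_ceil.
pose g (x : 'I_n) : E * 'I_c := enum_val (widen_ord nE x).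
have g_inj : injective g by move=> x y /enum_val_inj/(congr1 val)/= /val_inj.
have pos_lt (v : V * 'I_c) : t + enum_rank v < n.
  by apply: leq_trans tm_n; rewrite ltn_add2l.
pose pos v := Ordinal (pos_lt v).
have pos_inj : injective pos.
  by move=> u v /(congr1 val)/= /addnI/val_inj/enum_rank_inj.
exists m, (fun x => pos (src (g x).1, (g x).2)), (fun x => pos (dst (g x).1, (g x).2)).
split=> // [x|x|S St]; try by rewrite leq_addr ltn_add2l ltn_ord.
have gSt : #|[set g x | x in S]| <= t by rewrite card_imset.
have [f f_inj finc] := forest_upto_sdr (forest_upto_copies good) gSt.
exists (fun x => pos (f (g x))) => [x y xS yS /pos_inj/f_inj|x].
  by move=> fE; apply/g_inj/fE; apply: imset_f.
by move: (finc (g x)) => /orP[] /eqP <-; rewrite eqxx ?orbT.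
Qed.

(** * Routing tokens by choosing switches *)

Section Routing.
Variables (t n : nat).
Implicit Types (T : seq ('I_n * 'I_n)) (p q : 'I_t -> 'I_n).

(* Some choice of switches of [T] moves the tokens from positions [p] to [q]. *)
Definition routes T p q :=
  exists2 s, subseq s T & forall i, switch_prod s (p i) = q i.

Lemma routes_refl T p : routes T p p.
Proof. by exists [::] => [|i]; rewrite ?sub0seq // /switch_prod big_nil perm1. Qed.

Lemma routes_switch T a b p : (a, b) \in T -> routes T p (tperm a b \o p).
Proof.
move=> abT; exists [:: (a, b)]; first by rewrite sub1seq.
by move=> i; rewrite /switch_prod big_seq1.
Qed.

Lemma routes_cat T T' p q r : routes T p q -> routes T' q r -> routes (T ++ T') p r.
Proof.
move=> [s sT sq] [s' s'T s'r]; exists (s ++ s'); first exact: cat_subseq.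
by move=> i; rewrite /switch_prod big_cat permM [X in fun_of_perm _ X]sq; apply: s'r.
Qed.

Lemma routes_inj T p q : routes T p q -> injective p -> injective q.
Proof. by move=> [s _ sq] p_inj i j; rewrite -!sq => /perm_inj/p_inj. Qed.

Lemma routes_ext T p q r : routes T p q -> q =1 r -> routes T p r.
Proof. by move=> [s sT sq] qr; exists s => // i; rewrite sq qr. Qed.

Lemma routes_rev T p q : routes T p q -> routes (rev T) q p.
Proof.
move=> [s sT sq]; exists (rev s); first by rewrite subseq_rev.
move=> i; rewrite -sq -permM.
suff -> : (switch_prod s * switch_prod (rev s) = 1)%g by rewrite perm1.
elim: s {sT sq} => [|a s IH]; first by rewrite /switch_prod big_nil mulg1.
rewrite /switch_prod big_cons rev_cons -cats1 big_cat big_seq1 /=.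
rewrite -mulgA [X in (_ * X)%g]mulgA.
by rewrite [X in (_ * (X * _))%g]IH mul1g tperm2.
Qed.

Variable tn : t <= n.
Let home := widen_ord tn.

Lemma home_inj : injective home.
Proof. by move=> i j /(congr1 val)/= /val_inj. Qed.

Definition star (H : {set 'I_n}) (j : 'I_t) :=
  [seq (y, home j) | y <- enum (H :\ home j)].

Definition gather (H : {set 'I_n}) := flatten [seq star H j | j <- enum 'I_t].

(** Tokens are sent home one at a time. The swap for [j] moves any token found at [home j] to
    another point of [H], and it disturbs neither the tokens already home nor those outside [H]. *)
Lemma gather_routes (H : {set 'I_n}) p :
  (forall i, home i \in H) -> injective p ->
  routes (gather H) p (fun i => if p i \in H then home i else p i).
Proof.
move=> homeH p_inj.
suff [q pq [q_in q_notin]] : exists2 q, routes (gather H) p q &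
    (forall i, p i \in H -> q i \in H /\ (i \in enum 'I_t -> q i = home i)) /\
    (forall i, p i \notin H -> q i = p i).
  apply: routes_ext pq _ => i; case: ifPn => [piH|/q_notin //].
  by apply: (proj2 (q_in i piH)); rewrite mem_enum.
rewrite /gather; elim/last_ind: (enum _) => [|js j [q pq [q_in q_notin]]].
  by exists p; [apply: routes_refl | split].
have q_inj := routes_inj pq p_inj.
rewrite map_rcons flatten_rcons.
have [pjH|pjH] := boolP (p j \in H); last first.
  exists q; first exact/(routes_cat pq)/routes_refl.
  split=> // i piH; have [qiH qi] := q_in i piH; split=> //.
  by rewrite mem_rcons inE => /predU1P[ij|/qi //]; rewrite -ij piH in pjH.
have [qjH _] := q_in j pjH.
exists (tperm (q j) (home j) \o q).
  apply: (routes_cat pq); have [qj|qj] := eqVneq (q j) (home j).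
    by apply: (routes_ext (routes_refl _ _)) => i /=; rewrite qj tperm1 perm1.
  by apply/routes_switch/mapP; exists (q j); rewrite // mem_enum !inE qj.
split=> i piH /=.
  have [qiH qi] := q_in i piH; split; first by case: tpermP.
  rewrite mem_rcons inE; have [-> _|ij /= ijs] := eqVneq i j; first by rewrite tpermL.
  have := qi ijs; move=> {}qi; rewrite tpermD // ?(inj_eq q_inj) 1?eq_sym //.
  by rewrite qi (inj_eq home_inj).
by rewrite (q_notin i) // tpermD //; apply: contraNneq piH => <-.
Qed.

Lemma size_gather (H : {set 'I_n}) : size (gather H) <= t * #|H|.
Proof.
rewrite size_flatten /shape -map_comp sumnE big_map big_enum /=.
rewrite -[t in t * _]card_ord -sum_nat_const; apply: leq_sum => j _.
by rewrite size_map -cardE subset_leq_card ?subD1set.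
Qed.

Definition hub_stage (X : {set 'I_n}) (h1 h2 : 'I_n -> 'I_n) :=
  flatten [seq [:: (x, h1 x); (x, h2 x)] | x <- enum X].

(** When the token at [x] is switched with [f x], that hub is free: no token starts in [Y], and [f]
    sends the tokens moved earlier to other hubs. *)
Lemma hub_stage_routes (X Y : {set 'I_n}) h1 h2 f p :
    injective p -> [disjoint X & Y] -> (forall i, p i \notin Y) ->
    (forall x, f x \in Y) -> (forall x, (f x == h1 x) || (f x == h2 x)) ->
    {in [set p i | i : 'I_t & p i \in X] &, injective f} ->
  routes (hub_stage X h1 h2) p (fun i => if p i \in X then f (p i) else p i).
Proof.
move=> p_inj XY pY fY fh f_inj.
have XNY x : x \in X -> x \notin Y by move=> xX; rewrite (disjointFr XY).
suff: routes (hub_stage X h1 h2) p (fun i => if p i \in enum X then f (p i) else p i).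
  by move/routes_ext; apply=> i; rewrite mem_enum.
have : {subset enum X <= X} by move=> x; rewrite mem_enum.
have := enum_uniq X.
rewrite /hub_stage; elim/last_ind: (enum X) => [_ _|xs x IH].
  exact: routes_refl.
rewrite rcons_uniq map_rcons flatten_rcons => /andP[x_xs xs_uniq] xsX.
have xX : x \in X by apply: xsX; rewrite mem_rcons mem_head.
have {}xsX : {subset xs <= X} by move=> y yxs; apply: xsX; rewrite mem_rcons inE yxs orbT.
apply: (routes_cat (IH xs_uniq xsX)).
have [/existsP[i0 /eqP pi0]|/existsPn px] := boolP [exists i, p i == x]; last first.
  apply: (routes_ext (routes_refl _ _)) => i.
  by rewrite mem_rcons inE (negPf (px i)).
have : (x, f x) \in [:: (x, h1 x); (x, h2 x)].
  by rewrite !inE !xpair_eqE eqxx fh.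
move/routes_switch/routes_ext; apply=> i /=.
rewrite mem_rcons inE; have [->|pix] /= := eqVneq (p i) x.
  by rewrite (negPf x_xs) tpermL.
case: ifPn => [pixs|pixs]; rewrite tpermD //.
- by apply: contraNneq (XNY _ xX) => ->.
- apply: contra pix => /eqP/f_inj ->; rewrite // -?pi0 imset_f // inE ?pi0 //.
  exact: xsX.
- by rewrite eq_sym.
- by apply: contraNneq (pY i) => <-.
Qed.

Lemma size_hub_stage (X : {set 'I_n}) h1 h2 : size (hub_stage X h1 h2) <= 2 * n.
Proof.
rewrite size_flatten /shape -map_comp sumnE big_map big_enum /=.
by rewrite sum_nat_const mulnC leq_mul2l -[n in _ <= n]card_ord max_card.
Qed.

End Routing.

(** * Assembling the network and bounding its length *)

(* [size T - 2 * n] is truncated; the bound means [size T <= (2 + 1 / K) * n]. *)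
Lemma exists_reachability_network (t K : nat) : 0 < t -> 0 < K ->
  exists n0, forall n, n0 <= n ->
  exists2 T : seq ('I_n * 'I_n), reachability_network t T & K * (size T - 2 * n) <= n.
Proof.
move=> t0 K0.
(* The factor [2 * t] pays for two gatherings of at most [t * #|H|] switches each. *)
have [|n0 hubs] := exists_hubs t (K := K * (2 * t)); first by rewrite !muln_gt0 K0 t0.
exists n0 => n /hubs[m [h1 [h2 [Km h1P h2P hub]]]].
have tmn : t + m <= n by apply: leq_trans Km; rewrite leq_pmull // !muln_gt0 K0 t0.
have tn : t <= n by apply: leq_trans tmn; rewrite leq_addr.
pose H := [set x : 'I_n | x < t + m].
pose Y := [set x : 'I_n | t <= x < t + m].
have cardH : #|H| = t + m.
  rewrite -(card_ord (t + m)) -(card_imset predT (f := widen_ord tmn)); last first.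
    by move=> i j /(congr1 val)/= /val_inj.
  congr #|pred_of_set _|; apply/setP=> x; rewrite inE; apply/idP/imsetP => [xtm|[i _ ->] /=].
    by exists (Ordinal xtm); last exact: val_inj.
  by rewrite ltn_ord.
pose U := gather tn H ++ (hub_stage (~: H) h1 h2 ++ gather tn H).
have homeH i : widen_ord tn i \in H by rewrite inE /= ltn_addr.
have Y_H x : x \in Y -> x \in H by rewrite !inE => /andP[].
have h1H x : h1 x \in H by apply: Y_H; rewrite inE.
have h2H x : h2 x \in H by apply: Y_H; rewrite inE.
exists (rev U); last first.
  rewrite size_rev /U !size_cat.
  have := size_gather tn H; have := size_hub_stage (~: H) h1 h2.
  rewrite cardH; move: (size _) (size _) => a b a_le b_le.
  by apply: leq_trans Km; rewrite -mulnA leq_mul2l; apply/orP; right; lia.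
split; first by rewrite t0.
  rewrite all_rev; apply/allP => -[a b]; rewrite /= !mem_cat.
  suff gatherN : (a, b) \in gather tn H -> a != b.
    case/or3P => [/gatherN // | | /gatherN //].
    case/flatten_mapP => x; rewrite mem_enum inE => xH.
    by rewrite !inE => /orP[] /eqP[-> ->]; apply: contraNneq xH => ->.
  by case/flatten_mapP => j _ /mapP[y]; rewrite mem_enum !inE => /andP[yj _] [-> ->].
move=> x x_inj.
pose p1 i := if x i \in H then widen_ord tn i else x i.
have xp1 := gather_routes homeH x_inj.
have p1_inj : injective p1 := routes_inj xp1 x_inj.
pose S := [set p1 i | i : 'I_t & p1 i \in ~: H].
have St : #|S| <= t.
  by rewrite -[t in _ <= t]card_ord (leq_trans (leq_imset_card _ _)) ?max_card.
have [f f_inj fP] := hub S St.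
have fY y : f y \in Y by rewrite inE; case/orP: (fP y) => /eqP ->.
pose p2 i := if p1 i \in ~: H then f (p1 i) else p1 i.
have p12 : routes (hub_stage (~: H) h1 h2) p1 p2.
  apply: (@hub_stage_routes _ _ _ Y) => //.
    by rewrite disjoint_sym disjoints_subset setCK; apply/subsetP.
  (* After the first gathering the tokens in [H] sit at points below [t], so every hub is free. *)
  move=> i; rewrite /p1; case: ifP => [_|xH]; first by rewrite inE /= leqNgt ltn_ord.
  by apply: contraFN xH; apply: Y_H.
have p2H i : p2 i \in H.
  by rewrite /p2 in_setC; case: ifPn => [_|/negPn //]; apply: Y_H.
have p2_inj := routes_inj p12 p1_inj.
have home2 := routes_ext (gather_routes homeH p2_inj) (r := widen_ord tn).
have [|s sU sx] := routes_rev (routes_cat xp1 (routes_cat p12 (home2 _))).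
  by move=> i; rewrite p2H.
exists s => // i j ji; rewrite -sx; congr (switch_prod s _); exact: val_inj.
Qed.

Local Open Scope ring_scope.

Theorem theorem3 (R : realType) (t : nat) (ht : (3 <= t)%N)
    (delta : R) (hdelta : 0 < delta) :
  exists n0 : nat, forall n : nat, (n0 <= n)%N ->
    exists2 T : seq ('I_n * 'I_n), reachability_network t T &
      (size T)%:R <= (2 + delta) * n%:R.
Proof.
have [K K_ge] : exists K : nat, delta^-1 <= K%:R.
  by exists (Num.truncn delta^-1).+1; rewrite ltW // truncnS_gt.
have K0 : (0 < K)%N by rewrite -(ltr_nat R) (lt_le_trans _ K_ge) // invr_gt0.
have [|n0 net] := @exists_reachability_network t K _ K0; first exact: leq_trans ht.
exists n0 => n /net[T Tnet Tsize]; exists T => //.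
have le_size : (size T <= 2 * n + (size T - 2 * n))%N by rewrite -leq_subLR.
apply: (@le_trans _ _ (2 * n + (size T - 2 * n))%:R); first by rewrite ler_nat.
rewrite natrD natrM [leRHS]mulrDl lerD2l.
have Kdelta : 1 <= K%:R * delta by rewrite -ler_pdivrMr // mul1r.
have : (K * (size T - 2 * n))%:R <= n%:R :> R by rewrite ler_nat.
rewrite natrM => /(ler_wpM2l (ltW hdelta)); apply: le_trans.
by rewrite mulrA [delta * _]mulrC ler_peMl.
Qed.
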